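(* Let $\overline{\nabla}$ be a discrete gradient construction on $\mathbb{R}^n$ satisfying the Boundedness/Locality Assumption (with constant $C_n$ and function $\delta$) stated in the context, and let $V:\mathbb{R}^n\to\mathbb{R}$ be continuously differentiable. Then for every $\tau>0$ and every $x\in\mathbb{R}^n$ there exists a solution $y\in\mathbb{R}^n$ of $$y = x-\tau\,\overline{\nabla}V(x,y),$$ provided that $V$ satisfies any one of the following properties: (i) the gradient of $V$ is uniformly bounded on $\mathbb{R}^n$; (ii) $V$ is coercive; (iii) both $V$ and $\nabla V$ are uniformly bounded on the convex hull $\mathrm{co}(\{y\in\mathbb{R}^n : V(y)\le V(x)\})$ (the bounds may depend on $x$), and $\delta\equiv 0$ in the Assumption.
   Context: $\|\cdot\|$ and $\langle\cdot,\cdot\rangle$ are the Euclidean norm and inner product on $\mathbb{R}^n$. Discrete gradient: for a continuously differentiable $V:\mathbb{R}^n\to\mathbb{R}$, a discrete gradient is a continuous map $\overline{\nabla}V:\mathbb{R}^n\times\mathbb{R}^n\to\mathbb{R}^n$ such that for all $x,y\in\mathbb{R}^n$: $\langle\overline{\nabla}V(x,y),y-x\rangle=V(y)-V(x)$ (mean value property) and $\overline{\nabla}V(x,x)=\nabla V(x)$ (consistency property). A discrete gradient construction $\overline{\nabla}$ assigns to each $V\in C^1(\mathbb{R}^n;\mathbb{R})$ a discrete gradient $\overline{\nabla}V$. $V$ is coercive if the level set $\{x\in\mathbb{R}^n: V(x)\le M\}$ is bounded for each $M\in\mathbb{R}$. For $U\subset\mathbb{R}^n$ and $\delta\ge 0$,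 the $\delta$-thickening is $U_\delta:=\{x\in\mathbb{R}^n:\mathrm{dist}(U,x)\le\delta\}$ (with $U_\infty=\mathbb{R}^n$), and $\mathrm{diam}(U):=\sup_{x,y\in U}\|x-y\|$. Boundedness/Locality Assumption on $\overline{\nabla}$: there is a constant $C_n$ that depends on the discrete gradient construction but is independent of $V$, and a continuous, nondecreasing function $\delta:[0,\infty]\to[0,\infty]$ with $\delta(0)=0$ and $\delta(\infty):=\lim_{r\to\infty}\delta(r)$, such that for any $V\in C^1(\mathbb{R}^n;\mathbb{R})$ and any convex set $U\subset\mathbb{R}^n$ with nonempty interior: (a) if $\|\nabla V(x)\|\le K$ for all $x\in U_{\delta(\mathrm{diam}(U))}$, then $\|\overline{\nabla}V(x,y)\|\le C_nK$ for all $x,y\in U$; (b) if $W$ is another continuously differentiable function with $V(x)=W(x)$ for all $x\in U_{\delta(\mathrm{diam}(U))}$, then $\overline{\nabla}V(x,y)=\overline{\nabla}W(x,y)$ for all $x,y\in U$. *)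

(* Defs.v *)
From HB Require Import structures.
From mathcomp Require Import all_boot all_order all_algebra.
From mathcomp Require Import all_classical all_reals all_analysis.

Set Implicit Arguments.
Unset Strict Implicit.
Unset Printing Implicit Defensive.

Import Order.TTheory GRing.Theory Num.Theory.
Import numFieldNormedType.Exports.

Local Open Scope classical_set_scope.
Local Open Scope ring_scope.

(* R^n is 'rV[R]_n with its library (product) topology.  Its canonical norm
   `|x| is the sup norm, so the Euclidean structure is defined separately. *)

Definition dotp (R : realType) (n : nat) (u v : 'rV[R]_n) : R :=
  \sum_(i < n) u ord0 i * v ord0 i.

Definition enorm (R : realType) (n : nat) (u : 'rV[R]_n) : R :=
  Num.sqrt (dotp u u).

Definition grad (R : realType) (n : nat) (V : 'rV[R]_n -> R) (x : 'rV[R]_n) :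
    'rV[R]_n :=
  \row_(i < n) 'D_(delta_mx ord0 i) V x.

Definition C1 (R : realType) (n : nat) (V : 'rV[R]_n -> R) : Prop :=
  (forall x, differentiable V x) /\ continuous (grad V).

Record discrete_gradient (R : realType) (n : nat) (V : 'rV[R]_n -> R)
    (dV : 'rV[R]_n -> 'rV[R]_n -> 'rV[R]_n) : Prop := DiscreteGradient {
  dg_continuous :
    continuous (fun p : 'rV[R]_n * 'rV[R]_n => dV p.1 p.2) ;
  dg_mean_value : forall x y, dotp (dV x y) (y - x) = V y - V x ;
  dg_consistent : forall x, dV x x = grad V x }.

(* A construction is a total function on all V : R^n -> R; its values are
   constrained (and used) only when V is C^1. *)
Definition discrete_gradient_construction (R : realType) (n : nat)
    (dg : ('rV[R]_n -> R) -> 'rV[R]_n -> 'rV[R]_n -> 'rV[R]_n) : Prop :=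
  forall V, C1 V -> discrete_gradient V (dg V).

Definition coercive (R : realType) (n : nat) (V : 'rV[R]_n -> R) : Prop :=
  forall M : R, [bounded enorm x | x in [set x | V x <= M]].

Definition set_dist (R : realType) (n : nat) (U : set 'rV[R]_n)
    (x : 'rV[R]_n) : \bar R :=
  ereal_inf [set (enorm (x - u))%:E | u in U].

(* For d = +oo the condition always holds, so U_oo is the whole space. *)
Definition thickening (R : realType) (n : nat) (U : set 'rV[R]_n)
    (d : \bar R) : set 'rV[R]_n :=
  [set x | (set_dist U x <= d)%E].

Definition diam (R : realType) (n : nat) (U : set 'rV[R]_n) : \bar R :=
  ereal_sup [set (enorm (x - y))%:E | x in U & y in U].

Definition is_convex (R : realType) (n : nat) (U : set 'rV[R]_n) : Prop :=
  convex_set (U : set (convex_lmodType 'rV[R]_n)).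

Definition convex_hull (R : realType) (n : nat) (A : set 'rV[R]_n) :
    set 'rV[R]_n :=
  \bigcap_(C in [set C | is_convex C /\ A `<=` C]) C.

(* delta : [0, oo] -> [0, oo] is represented by a function on \bar R of which
   only the restriction to the nonnegative extended reals is constrained. *)
Record locality_function (R : realType) (delta : \bar R -> \bar R) : Prop :=
  LocalityFunction {
  delta_ge0 : forall r : \bar R, (0 <= r -> 0 <= delta r)%E ;
  delta_continuous :
    {within [set r : \bar R | (0 <= r)%E], continuous delta} ;
  delta_nondecreasing :
    forall r s : \bar R, (0 <= r -> r <= s -> delta r <= delta s)%E ;
  delta_0 : delta 0%E = 0%E ;
  delta_pinfty : delta r%:E @[r --> +oo%R] --> delta +oo%E }.

Record boundedness_locality (R : realType) (n : nat)
    (dg : ('rV[R]_n -> R) -> 'rV[R]_n -> 'rV[R]_n -> 'rV[R]_n)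
    (Cn : R) (delta : \bar R -> \bar R) : Prop := BoundednessLocality {
  bl_delta : locality_function delta ;
  bl_bounded : forall (V : 'rV[R]_n -> R) (U : set 'rV[R]_n) (K : R),
    C1 V -> is_convex U -> interior U !=set0 ->
    (forall x, thickening U (delta (diam U)) x -> enorm (grad V x) <= K) ->
    forall x y, U x -> U y -> enorm (dg V x y) <= Cn * K ;
  bl_local : forall (V W : 'rV[R]_n -> R) (U : set 'rV[R]_n),
    C1 V -> C1 W -> is_convex U -> interior U !=set0 ->
    (forall x, thickening U (delta (diam U)) x -> V x = W x) ->
    forall x y, U x -> U y -> dg V x y = dg W x y }.

(* Main.v *)
Require Import Defs.
From HB Require Import structures.
From mathcomp Require Import all_boot all_order all_algebra all_fingroup.
From mathcomp Require Import all_classical all_reals all_analysis.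
From mathcomp Require Import zify ring lra.

(* If y - x = s^-1 (- tau dV(x, y)) with s > 1 and y != x, the mean value
   property gives V(y) - V(x) = <dV(x, y), y - x> < 0.  Hence on a sphere around
   x on which every y satisfies V(x) <= V(y) or tau |dV(x, y)| < |y - x|, the
   map w |-> - tau dV(x, x + w) satisfies the Leray-Schauder condition, and it
   has a fixed point.  In case (i) the second alternative holds on large spheres,
   in case (ii) the first one, and in case (iii) the second one holds inside the
   hull of the sublevel set and the first one outside; if that hull has empty
   interior, then x is a global minimum.
   The fixed point theorem is Brouwer's, obtained from Sperner's lemma on the
   Kuhn triangulation of a cube.  The parity count is carried out in 'F_2, a
   fully labelled simplex being detected by the determinant of its incidence
   matrix between vertices and labels. *)

Set Implicit Arguments.
Unset Strict Implicit.
Unset Printing Implicit Defensive.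

Import Order.TTheory GRing.Theory Num.Theory.
Import numFieldNormedType.Exports.

Local Open Scope classical_set_scope.
Local Open Scope ring_scope.

(** * Sperner's lemma modulo 2 on the Kuhn triangulation *)

(** A label [>= n] gives a zero row and a repeated label two equal rows, so the value is 1 exactly
    when [L] permutes the numbers below [n]. *)
Definition label_det n (L : nat -> nat) : 'F_2 :=
  \det (\matrix_(a < n, b < n) (L a == b)%:R).

Lemma eq_label_det n (L L' : nat -> nat) :
  (forall a, (a < n)%N -> L a = L' a) -> label_det n L = label_det n L'.
Proof.
move=> LL'; congr (\det _); apply/matrixP => a b.
by rewrite !mxE LL'.
Qed.

Lemma label_det_missing n (L : nat -> nat) b :
  (b < n)%N -> (forall a, (a < n)%N -> L a != b) -> label_det n L = 0.
Proof.
move=> bn Lb; rewrite /label_det (expand_det_col _ (Ordinal bn)) big1// => a _.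
by rewrite mxE /= (negbTE (Lb a (ltn_ord a))) mul0r.
Qed.

(* The columns of the incidence matrix add up to the all-ones vector, which may
   therefore replace the last column before expanding along it. *)
Lemma label_det_facets n (L : nat -> nat) : (forall a, L a <= n)%N ->
  label_det n.+1 L = \sum_(k < n.+1) label_det n (L \o bump k).
Proof.
move=> Ln; rewrite /label_det; set A := \matrix_(_, _) _.
have -> : \det A = \sum_(b < n.+1) (\adj A *m A) ord_max b.
  rewrite mul_adj_mx (bigD1 ord_max)//= mxE eqxx big1 ?addr0// => b bmax.
  by rewrite mxE eq_sym (negbTE bmax).
under eq_bigr do rewrite mxE.
rewrite exchange_big /=; apply: eq_bigr => a _.
rewrite -big_distrr /= (bigD1 (inord (L a)))//= big1 => [|b].
  rewrite [A _ _]mxE inordK ?ltnS// eqxx addr0 mulr1 mxE /cofactor.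
  rewrite oppr_pchar2 ?pchar_Fp// expr1n mul1r; congr (\det _).
  by apply/matrixP => i j; rewrite !mxE lift_max.
rewrite [A _ _]mxE -val_eqE /= inordK ?ltnS// eq_sym => /negbTE ->.
by [].
Qed.

(* A simplex of the Kuhn triangulation is a base point q and an order t in which
   the coordinates are incremented: its k-th vertex has incremented those of
   rank less than k. *)
Definition kuhn_vertex m (q : {ffun 'I_m -> nat}) (t : 'S_m) (k : nat) :
    {ffun 'I_m -> nat} :=
  [ffun i => (q i + (t i < k))%N].

Definition grid_point m p (q : {ffun 'I_m -> 'I_p}) : {ffun 'I_m -> nat} :=
  [ffun i => nat_of_ord (q i)].

(** Sperner boundary conditions for the labels [0..m] on the grid [[0, p]^m]. They are asymmetric so
    that in dimension [m.+1] only the face where the last coordinate is [p] can carry all of [0..m];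
    this drives the induction on the dimension. *)
Definition kuhn_label m p (l : {ffun 'I_m -> nat} -> nat) :=
  forall u : {ffun 'I_m -> nat}, (forall i, u i <= p)%N ->
  [/\ (l u <= m)%N, forall i, u i = 0%N -> l u != i :> nat
    & forall i, u i = p -> (l u <= i)%N].

(* Exchanging the ranks k-1 and k changes only the vertex k, so the facets
   opposite to it cancel in pairs. *)
Lemma sum_interior_facet m p (q : {ffun 'I_m.+1 -> nat}) l k :
  (0 < k < m.+1)%N ->
  \sum_(t : 'S_m.+1)
    label_det p ((fun c => l (kuhn_vertex q t c)) \o bump k) = 0.
Proof.
move=> /andP[k0 km].
pose a : 'I_m.+1 := inord k.-1; pose b : 'I_m.+1 := inord k.
have aE : a = k.-1 :> nat by rewrite inordK//; lia.
have bE : b = k :> nat by rewrite inordK//; lia.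
have ab : a != b by rewrite -val_eqE /= aE bE; lia.
(* Right multiplication by [tperm a b] matches the odd permutations with the even ones, and equal
   terms add up to 0 modulo 2. *)
rewrite (bigID (@odd_perm _)) /= (reindex_inj (mulIg (tperm a b))) /=.
under eq_bigl do rewrite odd_permM odd_tperm ab addbT.
set S := (X in _ + X); rewrite -[RHS](addrr_pchar2 (pchar_Fp (isT : prime 2)) S).
congr (_ + _); apply: eq_bigr => t _; apply: eq_label_det => c _ /=.
congr (l _).
apply/ffunP => i; rewrite !ffunE permM; congr (_ + nat_of_bool _)%N.
case: tpermP => [->|->|//]; rewrite ?aE ?bE /bump; lia.
Qed.

Definition raise m (q : {ffun 'I_m -> nat}) j : {ffun 'I_m -> nat} :=
  [ffun i => (q i + (i == j))%N].

(** The coordinate [j] is incremented first by [t] and last by [t']. Hence the facet opposite vertex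
    0 of one simplex is the facet opposite the last vertex of a simplex in the cell raised along
    [j]. *)
Lemma kuhn_vertex_rot m (q : {ffun 'I_m.+1 -> nat}) (t t' : 'S_m.+1) j k :
  (forall i, t' i = ord_pred (t i)) -> t' j = ord_max -> (k <= m)%N ->
  kuhn_vertex q t k.+1 =
  kuhn_vertex (raise q j) t' k.
Proof.
move=> tt' t'j km; apply/ffunP => i; rewrite !ffunE -addnA; congr (_ + _)%N.
have [->|ij] := eqVneq i j.
  have -> : t j = ord0.
    by rewrite -[t j]ord_predK -tt' t'j; apply: val_inj; rewrite /= modnn.
  by rewrite t'j /=; lia.
rewrite add0n ltnS; congr nat_of_bool.
have : t' i != ord_max by rewrite -t'j (inj_eq perm_inj).
rewrite tt' -(inj_eq (@ordS_inj _)) ord_predK => ti.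
have ti0 : (0 < t i)%N.
  by move: ti; rewrite lt0n; apply: contra => /eqP ti;
    apply/eqP/val_inj; rewrite /= modnn.
have := ltn_ord (t i) => tim /=.
have -> : ((t i + m.+1).-1 = (t i).-1 + m.+1)%N by lia.
rewrite modnDr modn_small; lia.
Qed.

Definition ext_point m p (u : {ffun 'I_m -> nat}) : {ffun 'I_m.+1 -> nat} :=
  [ffun i => oapp u p (unlift ord_max i)].

Lemma kuhn_label_ext m p l :
  @kuhn_label m.+1 p l -> @kuhn_label m p (l \o ext_point p).
Proof.
move=> lP u up; have uP i : (ext_point p u i <= p)%N.
  by rewrite ffunE; case: unliftP => [j|] _ /=.
have extE i : ext_point p u (lift ord_max i) = u i by rewrite ffunE liftK.
have [_ l0 lp] := lP _ uP; split=> [|i|i] /=.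
- by have := lp ord_max; rewrite ffunE unlift_none; apply.
- by rewrite -extE => /l0; rewrite lift_max.
- by rewrite -extE => /lp; rewrite lift_max.
Qed.

Lemma kuhn_vertex_le m p (q : {ffun 'I_m -> 'I_p}) t k i :
  (kuhn_vertex (grid_point q) t k i <= p)%N.
Proof. by rewrite !ffunE; have := ltn_ord (q i); lia. Qed.

Definition kuhn_count m p (l : {ffun 'I_m -> nat} -> nat) : 'F_2 :=
  \sum_(q : {ffun 'I_m -> 'I_p}) \sum_(t : 'S_m)
    label_det m.+1 (l \o kuhn_vertex (grid_point q) t).

(** Only the vertices [0..m] out of [m.+2] enter: this is the facet opposite the last vertex, on
    which the coordinate of rank [ord_max] is constant. *)
Definition facet_det m (l : {ffun 'I_m.+1 -> nat} -> nat) q t :=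
  label_det m.+1 (l \o kuhn_vertex q t).

(** Only the facets opposite the first and the last vertex survive the sum over [t]; the former are
    rewritten by shifting [t] cyclically. *)
Lemma kuhn_count_facets m p l : @kuhn_label m.+1 p l ->
  kuhn_count p l = \sum_(t : 'S_m.+1) \sum_(q : {ffun 'I_m.+1 -> 'I_p})
    (facet_det l (raise (grid_point q) (t^-1%g ord_max)) t
     + facet_det l (grid_point q) t).
Proof.
move=> lP; rewrite exchange_big /=; apply: eq_bigr => q _.
transitivity (\sum_(t : 'S_m.+1) \sum_(k < m.+2)
    label_det m.+1 ((l \o kuhn_vertex (grid_point q) t) \o bump k)).
  apply: eq_bigr => t _; rewrite label_det_facets// => k /=.
  by have [] := lP _ (kuhn_vertex_le q t k).
rewrite exchange_big big_ord_recl big_ord_recr /=.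
rewrite [X in _ + (X + _)]big1 => [|k _]; last first.
  by rewrite sum_interior_facet//; have := ltn_ord k; rewrite /= /bump; lia.
rewrite add0r big_split /=; congr (_ + _); last first.
  apply: eq_bigr => t _; apply: eq_label_det => k km /=.
  by rewrite /bump; congr (l (kuhn_vertex _ _ _)); lia.
pose s := perm (@ord_pred_inj m.+1).
rewrite [RHS](reindex_inj (mulIg s)) /=.
apply: eq_bigr => t _; apply: eq_label_det => k km /=; congr (l _).
apply: kuhn_vertex_rot; last by rewrite -ltnS.
  by move=> i; rewrite permM permE.
by rewrite permKV.
Qed.

(** The coordinate [j] is 0 at all vertices of the facet, so the label [j] is missing. *)
Lemma facet_det_bottom m p l (q : {ffun 'I_m.+1 -> 'I_p}) (t : 'S_m.+1) :
  kuhn_label p l -> nat_of_ord (q (t^-1%g ord_max)) = 0%N ->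
  facet_det l (grid_point q) t = 0.
Proof.
set j := t^-1%g _ => lP qj; apply: (label_det_missing (ltn_ord j)) => k km /=.
have [_ + _] := lP _ (kuhn_vertex_le q t k); apply.
by rewrite !ffunE qj permKV /=; lia.
Qed.

(** The coordinate [j] is [p] at all vertices of the facet, so the labels are at most [j < m] and
    the label [m] is missing. *)
Lemma facet_det_top m p l (q : {ffun 'I_m.+1 -> 'I_p}) (t : 'S_m.+1) :
  let j := t^-1%g ord_max in
  kuhn_label p l -> (q j).+1 = p -> j != ord_max ->
  facet_det l (raise (grid_point q) j) t = 0.
Proof.
move=> j lP qj jmax; apply: (label_det_missing (ltnSn m)) => k km /=.
set u := kuhn_vertex _ _ _.
have uj : u j = p by rewrite !ffunE eqxx permKV /=; lia.
have [i|_ _ /(_ _ uj)] := lP u.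
  have [->|ij] := eqVneq i j; first by rewrite uj.
  by rewrite !ffunE (negbTE ij); have := ltn_ord (q i); lia.
have : (j < m)%N.
  by move: jmax; rewrite -val_eqE /=; have := ltn_ord j; lia.
lia.
Qed.

Definition map_at m (T : Type) (f : T -> T) j (q : {ffun 'I_m -> T}) :
    {ffun 'I_m -> T} :=
  [ffun i => if i == j then f (q i) else q i].

Lemma map_at_bij m (T : Type) (f : T -> T) (j : 'I_m) :
  bijective f -> bijective (map_at f j).
Proof.
move=> [g fK gK]; exists (map_at g j) => q; apply/ffunP => i; rewrite !ffunE;
  by case: eqP => // _; rewrite ?fK ?gK.
Qed.

(* Adjacent cells cancel along direction j; the reindexing is cyclic, and the
   term at q j = 0 vanishes. *)
Lemma facet_det_telescope m p l (t : 'S_m.+1) : @kuhn_label m.+1 p l ->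
  let j := t^-1%g ord_max in
  \sum_(q : {ffun 'I_m.+1 -> 'I_p})
    (facet_det l (raise (grid_point q) j) t + facet_det l (grid_point q) t) =
  \sum_(q : {ffun 'I_m.+1 -> 'I_p} | (j == ord_max) && ((q j).+1 == p))
    facet_det l (raise (grid_point q) j) t.
Proof.
move=> lP j; rewrite big_split /=.
rewrite [X in _ + X](reindex _ (onW_bij _ (map_at_bij j (@ordS_bij p)))).
rewrite -big_split [RHS]big_mkcond /=; apply: eq_bigr => q _.
have [qj|qj] := eqVneq (q j).+1 p.
  rewrite [X in _ + X]facet_det_bottom//; last by rewrite ffunE eqxx /= qj modnn.
  rewrite addr0 andbT; case: eqP => // /eqP jmax.
  by rewrite facet_det_top.
rewrite andbF; set x := facet_det l _ t.
rewrite [X in _ + X](_ : _ = x) ?addrr_pchar2 ?pchar_Fp//.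
congr (facet_det _ _ _); apply/ffunP => i; rewrite !ffunE.
have [->/=|_] := eqVneq i j; last by rewrite addn0.
by rewrite modn_small; have := ltn_ord (q j); lia.
Qed.

Lemma lift_perm_onto n i j (s : 'S_n.+1) :
  s i = j -> exists t, lift_perm i j t = s.
Proof.
move=> sij; pose f k := odflt k (unlift j (s (lift i k))).
have fE k : lift j (f k) = s (lift i k).
  have : s (lift i k) != j by rewrite -sij (inj_eq perm_inj) eq_sym neq_lift.
  by rewrite eq_sym /f => /unlift_some[k' -> ->].
have f_inj : injective f.
  by move=> k k' /(congr1 (lift j)); rewrite !fE => /perm_inj/lift_inj.
exists (perm f_inj); apply/permP => k.
by case: (unliftP i k) => [k' ->|->]; rewrite ?lift_perm_id// lift_perm_lift permE.
Qed.

Lemma lift_perm_bij n i j :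
  {on [pred s : 'S_n.+1 | s i == j], bijective (lift_perm i j)}.
Proof.
exists (fun s => odflt 1%g [pick t | lift_perm i j t == s]) => [t _|s].
  case: pickP => [t' /eqP tt'|/(_ t)]; last by rewrite eqxx.
  apply/permP => k; apply: (@lift_inj _ j).
  by rewrite -!(lift_perm_lift i) tt'.
rewrite inE => /eqP/lift_perm_onto[t ts].
by case: pickP => [t' /eqP//|/(_ t)]; rewrite ts eqxx.
Qed.

(** The facets left over lie in the face where the last coordinate is [p], and there they are the
    simplices of the Kuhn triangulation one dimension lower. *)
Lemma kuhn_count_step m p l : (0 < p)%N -> @kuhn_label m.+1 p l ->
  kuhn_count p l = kuhn_count p (l \o ext_point p).
Proof.
move=> p0 lP; rewrite kuhn_count_facets// /kuhn_count [RHS]exchange_big /=.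
rewrite (bigID (fun t : 'S_m.+1 => t ord_max == ord_max)) /=.
rewrite addrC big1 ?add0r => [|t tmax].
  rewrite (reindex (lift_perm ord_max ord_max)); last exact: lift_perm_bij.
  apply: eq_big => [t|t _]; first by rewrite lift_perm_id eqxx.
  rewrite facet_det_telescope// lift_permV lift_perm_id eqxx /=.
  (* [rev_ord (Ordinal p0)] is [p - 1]: raising this last cell puts the facet at height [p]. *)
  pose h (q : {ffun 'I_m -> 'I_p}) : {ffun 'I_m.+1 -> 'I_p} :=
    [ffun i => if unlift ord_max i is Some j then q j else rev_ord (Ordinal p0)].
  rewrite (reindex h); last first.
    pose g (q : {ffun 'I_m.+1 -> 'I_p}) : {ffun 'I_m -> 'I_p} :=
      [ffun i => q (lift ord_max i)].
    exists g => [q _|q].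
      by apply/ffunP => i; rewrite !ffunE liftK.
    rewrite inE => /eqP qmax; apply/ffunP => i; rewrite !ffunE.
    by case: unliftP => [j ->|->]; rewrite ?ffunE//; apply: val_inj; rewrite /=; lia.
  apply: eq_big => [q|q _]; first by rewrite ffunE unlift_none /=; lia.
  apply: eq_label_det => k km /=; congr (l _); apply/ffunP => i; rewrite !ffunE.
  case: unliftP => [j ->|->] /=.
    by rewrite !ffunE eq_sym (negbTE (neq_lift _ _)) addn0 lift_perm_lift lift_max.
  by rewrite eqxx lift_perm_id /=; lia.
rewrite facet_det_telescope// big_pred0// => q.
rewrite [_ == _](_ : _ = false)//; apply: contraNF tmax => /eqP {1}<-.
by rewrite permKV.
Qed.

Lemma kuhn_count1 m p l : (0 < p)%N -> @kuhn_label m p l -> kuhn_count p l = 1.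
Proof.
move=> p0; elim: m l => [|m IH] l lP; last first.
  by rewrite kuhn_count_step// IH//; exact: kuhn_label_ext.
have q0 : {ffun 'I_0 -> 'I_p} by exact: [ffun=> Ordinal p0].
rewrite /kuhn_count (big_pred1 q0) => [|q]; last first.
  by apply/esym/eqP/ffunP => -[].
rewrite (big_pred1 1%g) => [|t]; last by apply/esym/eqP/permP => -[].
rewrite /label_det det_mx11 mxE /=.
have [] := lP _ (kuhn_vertex_le q0 1 0).
by rewrite leqn0 => ->.
Qed.

Lemma kuhn_full_cell m p l : (0 < p)%N -> @kuhn_label m p l ->
  exists (q : {ffun 'I_m -> 'I_p}) (t : 'S_m), forall b, (b <= m)%N ->
  exists k, l (kuhn_vertex (grid_point q) t k) = b.
Proof.
move=> p0 lP; apply: contrapT => no_cell.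
have := kuhn_count1 p0 lP; rewrite /kuhn_count big1 => [/esym/eqP|q _].
  by rewrite oner_eq0.
apply: big1 => t _; apply: contrapT => det0; apply: no_cell; exists q, t => b bm.
apply: contrapT => lb; apply: det0; apply: (@label_det_missing _ _ b) => // k _.
by apply/eqP => lk; apply: lb; exists k.
Qed.

(** Label [u] by the first [i] with [a u i], or by [m] if there is none. In a fully labelled simplex
    the vertex labelled [m] serves as [u] for every [i], and the one labelled [i] as [v]. *)
Lemma kuhn_cell m p (a : {ffun 'I_m -> nat} -> 'I_m -> bool) : (0 < p)%N ->
  (forall (u : {ffun 'I_m -> nat}) i, u i = 0%N -> ~~ a u i) ->
  (forall (u : {ffun 'I_m -> nat}) i, u i = p -> a u i) ->
  exists q : {ffun 'I_m -> 'I_p}, forall i : 'I_m, exists u v : {ffun 'I_m -> nat},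
  [/\ forall j, (q j <= u j <= (q j).+1)%N, forall j, (q j <= v j <= (q j).+1)%N,
    ~~ a u i & a v i].
Proof.
move=> p0 a0 ap; pose l u := find (a u) (enum 'I_m).
have l_lt u (i : 'I_m) : l u = i -> a u i.
  move=> lui; have : has (a u) (enum 'I_m).
    by rewrite has_find size_enum_ord -/(l u) lui.
  by move=> /(nth_find i); rewrite -/(l u) lui nth_ord_enum.
have l_le u (i : 'I_m) : a u i -> (l u <= i)%N.
  by move=> aui; rewrite leqNgt; apply: contraTN aui => /(before_find i);
    rewrite nth_ord_enum => ->.
have lP : kuhn_label p l.
  move=> u _; split=> [|i ui0|i /ap/l_le//].
    by rewrite -[leqRHS](size_enum_ord m) find_size.
  by apply/eqP => /l_lt; apply/negP; exact: a0.
have [q [t qt]] := kuhn_full_cell p0 lP; exists q => i.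
have [k lk] := qt m (leqnn m); have [k' lk'] := qt i (ltnW (ltn_ord i)).
exists (kuhn_vertex (grid_point q) t k), (kuhn_vertex (grid_point q) t k').
split; last exact: l_lt; try by move=> j; rewrite !ffunE; lia.
by apply: contraTN (ltn_ord i) => /l_le; rewrite lk -leqNgt.
Qed.

(** * Brouwer's and the Leray-Schauder fixed point theorems *)

Lemma rV_normP (R : realType) n (x : 'rV[R]_n) r : 0 <= r ->
  (forall i, `|x ord0 i| <= r) <-> `|x| <= r.
Proof.
move=> r0; rewrite [`|x|]mx_normrE; split=> [xr|xr i].
  by apply: bigmax_le => // -[i j] _ /=; rewrite ord1.
apply: le_trans xr.
exact: (@le_bigmax _ _ _ 0 (fun ij => `|x ij.1 ij.2|) (ord0, i)).
Qed.

(** At each mesh some cell has, for every [i], vertices where the [i]-th coordinate of [f x - x] is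
    nonnegative and nonpositive. These cells accumulate at a point [z] by compactness, and
    continuity makes every coordinate of [f z - z] vanish. *)
Lemma brouwer_box (R : realType) n (f : 'rV[R]_n -> 'rV[R]_n) r : 0 < r ->
  continuous f -> (forall x, `|x| <= r -> `|f x| <= r) -> exists x, f x = x.
Proof.
move=> r0 fc fr.
pose pt p (u : {ffun 'I_n -> nat}) : 'rV[R]_n :=
  \row_i (r * (2 * (u i)%:R / p%:R - 1)).
have pt_r p (u : {ffun 'I_n -> nat}) :
    (0 < p)%N -> (forall i, u i <= p)%N -> `|pt p u| <= r.
  move=> p0 up; apply/rV_normP => [|i]; first exact: ltW.
  rewrite mxE normrM gtr0_norm// ger_pMr// ler_norml.
  have : 0 <= (u i)%:R / p%:R :> R by rewrite divr_ge0.
  have : (u i)%:R / p%:R <= 1 :> R.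
    by rewrite ler_pdivrMr ?ltr0n// mul1r ler_nat.
  lra.
(* Forcing the label at u i = p is harmless: there the i-th coordinate of the
   point is r, which bounds f. *)
pose a p (u : {ffun 'I_n -> nat}) i :=
  (0 < u i)%N && ((u i == p) || (f (pt p u) ord0 i <= pt p u ord0 i)).
have cell p : (0 < p)%N -> exists q : {ffun 'I_n -> nat},
    (forall i, (q i <= p)%N) /\ forall i, exists u v : 'rV[R]_n,
    [/\ `|pt p q - u| <= 2 * r / p%:R, `|pt p q - v| <= 2 * r / p%:R,
      u ord0 i <= f u ord0 i & f v ord0 i <= v ord0 i].
  move=> p0.
  have [u i|u i|q qP] := kuhn_cell (a := a p) p0.
  - by rewrite /a => ->.
  - by rewrite /a => ->; rewrite p0 eqxx.
  have qp i : (q i < p)%N by [].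
  exists [ffun i => nat_of_ord (q i)]; split => [i|i]; first by rewrite ffunE ltnW.
  have [u [v [qu qv au av]]] := qP i.
  have close (w : {ffun 'I_n -> nat}) : (forall j, q j <= w j <= (q j).+1)%N ->
      `|pt p [ffun i => nat_of_ord (q i)] - pt p w| <= 2 * r / p%:R.
    move=> qw; apply/rV_normP => [|j]; first by rewrite divr_ge0// mulr_ge0// ltW.
    rewrite !mxE ffunE.
    have -> : r * (2 * (q j)%:R / p%:R - 1) - r * (2 * (w j)%:R / p%:R - 1) =
      (2 * r / p%:R) * ((q j)%:R - (w j)%:R) by ring.
    have rp0 : 0 <= 2 * r / p%:R by rewrite divr_ge0// mulr_ge0// ltW.
    rewrite normrM (ger0_norm rp0); apply: ler_piMr => //.
    have /andP[] := qw j; rewrite -!(ler_nat R) -natr1 ler_norml; lra.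
  have le_p (w : {ffun 'I_n -> nat}) :
      (forall j, q j <= w j <= (q j).+1)%N -> (forall j, w j <= p)%N.
    by move=> qw j; have := qw j; have := qp j; lia.
  have fpt (w : {ffun 'I_n -> nat}) j :
      (forall j, q j <= w j <= (q j).+1)%N -> `|f (pt p w) ord0 j| <= r.
    move=> qw; move: j; apply/rV_normP; first exact: ltW.
    by apply/fr/pt_r => //; exact: le_p.
  exists (pt p u), (pt p v); split; [exact: close|exact: close| |].
    move: au; rewrite /a negb_and negb_or -eqn0Ngt -ltNge.
    (* If [u i = 0], the [i]-th coordinate of the point is [- r], a lower bound for [f]. *)
    case/orP => [/eqP ui|/andP[_ /ltW]//].
    have := fpt u i qu; rewrite ler_norml => /andP[+ _]; apply: le_trans.
    by rewrite mxE ui; lra.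
  move: av => /andP[_ /orP[/eqP vi|//]].
  have := fpt v i qv; rewrite ler_norml => /andP[_]; move/le_trans; apply.
  by rewrite mxE vi mulfK ?pnatr_eq0; [lra|lia].
have [q qP] := choice (fun p : nat => cell p.+1 (ltn0Sn p)).
pose y p := pt p.+1 (q p).
have boxc : compact [set v : 'rV[R]_n | forall i, v ord0 i \in `[- r, r]].
  by apply: (@rV_compact _ _ (fun=> `[- r, r]%classic)) => _; exact: segment_compact.
have [|z [_ zcl]] := boxc (y @ \oo) _.
  exists 0%N => // p _ i /=.
  rewrite in_itv /= -ler_norml; move: i; apply/rV_normP; first exact: ltW.
  by apply: pt_r => // j; have [] := qP p.
exists z; apply/rowP => i.
have approx (e : R) : 0 < e -> exists u v : 'rV[R]_n,
    [/\ `|z - u| < e, `|z - v| < e, u ord0 i <= f u ord0 i & f v ord0 i <= v ord0 i].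
  move=> e0; have e2 : 0 < e / 2 by lra.
  have [N _ NP] : \forall p \near \oo, 2 * r / p.+1%:R < e / 2.
    have d0 : 0 < e / 2 / (2 * r) by rewrite divr_gt0// mulr_gt0.
    near=> p; rewrite mulrC -ltr_pdivlMr ?mulr_gt0//.
    by near: p; exact: (near_infty_natSinv_lt (PosNum d0)).
  have [_ [[p /= Np <-] zp]] : y @` [set p | (N <= p)%N] `&` ball z (e / 2) !=set0.
    apply: zcl; last exact: nbhsx_ballx.
    by exists N => // p Np; exists p.
  have [_ /(_ i)[u [v [yu yv uf fv]]]] := qP p; exists u, v.
  have rp := NP p Np.
  move: zp; rewrite -ball_normE /= => zp.
  split=> //.
  - rewrite (le_lt_trans (ler_distD (y p) _ _))// [e]splitr ltrD//.
    exact: le_lt_trans yu rp.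
  - rewrite (le_lt_trans (ler_distD (y p) _ _))// [e]splitr ltrD//.
    exact: le_lt_trans yv rp.
have gc : continuous (fun x => f x ord0 i - x ord0 i).
  move=> x; apply: (@continuousB _ _ _ (fun x => f x ord0 i)).
    apply: (@continuous_comp _ _ _ f (fun w : 'rV[R]_n => w ord0 i));
      first exact: fc.
    exact: coord_continuous.
  exact: coord_continuous.
apply/eqP; rewrite -subr_eq0 eq_le; apply/andP.
split; apply/negPn/negP; rewrite -ltNge => gz.
  have /nbhs_ballP[e e0 eP] : \forall x \near z, 0 < f x ord0 i - x ord0 i.
    exact: cvgr_gt (gc z) _ gz.
  have [u [v [_ zv _ fv]]] := approx e e0.
  by have := eP v; rewrite -ball_normE /= => /(_ zv); rewrite subr_gt0 ltNge fv.
have /nbhs_ballP[e e0 eP] : \forall x \near z, f x ord0 i - x ord0 i < 0.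
    exact: cvgr_lt (gc z) _ gz.
have [u [v [zu _ uf _]]] := approx e e0.
by have := eP u; rewrite -ball_normE /= => /(_ zu); rewrite subr_lt0 ltNge uf.
Unshelve. all: by end_near. Qed.

(** Brouwer applies to [P \o f \o P] with [P] the radial retraction onto the ball. A fixed point [x]
    satisfies [x = P (f x)]; if [f x] left the ball, it would be a multiple of [x] by
    [|f x| / r > 1] with [|x| = r]. *)
Lemma leray_schauder (R : realType) n (f : 'rV[R]_n -> 'rV[R]_n) r : 0 < r ->
  continuous f -> (forall x s, `|x| = r -> 1 < s -> f x <> s *: x) ->
  exists x, f x = x.
Proof.
move=> r0 fc fP.
have max0 (x : 'rV[R]_n) : 0 < Num.max r `|x| by rewrite lt_max r0.
pose P (x : 'rV[R]_n) : 'rV[R]_n := (r / Num.max r `|x|) *: x.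
have P_r x : `|P x| <= r.
  rewrite normrZ gtr0_norm ?divr_gt0// mulrAC -mulrA ger_pMr//.
  by rewrite ler_pdivrMr// mul1r le_max lexx orbT.
have Pc : continuous P.
  move=> x; apply: (@continuousZ _ _ _ (fun x => r / Num.max r `|x|) id);
    last exact: cvg_id.
  apply: (@continuousM _ _ (fun=> r)); first exact: cst_continuous.
  apply: continuousV; first exact: lt0r_neq0.
  apply: (@continuous_max _ _ (fun=> r) Num.norm x); first exact: cst_continuous.
  exact: norm_continuous.
have [|x _|x xE] := @brouwer_box R n (P \o f \o P) r r0 => /=.
- move=> x; apply: continuous_comp; first exact: Pc.
  by apply: continuous_comp; [exact: fc|exact: Pc].
- exact: P_r.
have xr : `|x| <= r by rewrite -xE P_r.
have Px : P x = x by rewrite /P max_l// divff ?scale1r// lt0r_neq0.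
move: xE; rewrite /= Px => xE; exists x.
have [fxr|rfx] := leP `|f x| r.
  by rewrite -[RHS]xE /P max_l// divff ?scale1r// lt0r_neq0.
have f0 : 0 < `|f x| by exact: lt_trans rfx.
have xE' : x = (r / `|f x|) *: f x by rewrite -[LHS]xE /P max_r// ltW.
have := fP x (`|f x| / r); case.
- by rewrite xE' normrZ gtr0_norm ?divr_gt0// divfK// lt0r_neq0.
- by rewrite ltr_pdivlMr// mul1r.
- rewrite [X in _ *: X]xE' scalerA mulrA divfK ?lt0r_neq0//.
  by rewrite divff ?scale1r// lt0r_neq0.
Qed.

(** * Euclidean estimates and the existence of a discrete gradient step *)

Lemma dotpZl (R : realType) n (a : R) (u v : 'rV[R]_n) :
  dotp (a *: u) v = a * dotp u v.
Proof. by rewrite /dotp mulr_sumr; apply: eq_bigr => i _; rewrite mxE mulrA. Qed.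

Lemma normr_le_enorm (R : realType) n (u : 'rV[R]_n) : `|u| <= enorm u.
Proof.
apply/rV_normP => [|i]; first exact: sqrtr_ge0.
rewrite -sqrtr_sqr ler_wsqrtr// /dotp (bigD1 i)//= -expr2 lerDl.
by apply: sumr_ge0 => j _; rewrite -expr2 sqr_ge0.
Qed.

Lemma dotp_gt0 (R : realType) n (u : 'rV[R]_n) : u != 0 -> 0 < dotp u u.
Proof.
move=> u0; rewrite -sqrtr_gt0.
by apply: lt_le_trans (normr_le_enorm u); rewrite normr_gt0.
Qed.

Lemma continuous_enorm (R : realType) n : continuous (@enorm R n).
Proof.
move=> u; apply: (@continuous_comp _ _ _ (fun u : 'rV[R]_n => dotp u u) Num.sqrt).
  move: u; apply: (@continuous_big _ _ +%R) => [|i _ u]; first exact: add_continuous.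
  by apply: continuousM; exact: coord_continuous.
exact: sqrt_continuous.
Qed.

Lemma bounded_exists (R : realType) T (A : set T) (f : T -> R) :
  [bounded f z | z in A] -> exists K, forall z, A z -> `|f z| <= K.
Proof.
by move=> [M [_ MP]]; exists (M + 1) => z; apply: MP; rewrite ltrDl.
Qed.

Lemma discrete_gradient_step (R : realType) n (V : 'rV[R]_n -> R) dV tau M x :
  discrete_gradient V dV -> 0 < tau ->
  (forall y, M < `|y - x| -> V x <= V y \/ `|dV x y| <= M) ->
  exists y, y = x - tau *: dV x y.
Proof.
move=> [dVc dV_mean _] tau0 VM.
pose f w := - (tau *: dV x (x + w)).
(* The radius exceeds [M], so that the hypothesis applies on the sphere, and [tau * |M|], so that
   the second alternative contradicts [1 < s]. *)
have r0 : 0 < `|M| + tau * `|M| + 1 by rewrite ltr_wpDl// addr_ge0// mulr_ge0// ltW.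
have fc : continuous f.
  move=> w; apply: (@continuousN _ _ _ (fun w => tau *: dV x (x + w))).
  apply: (@continuousZr _ _ _ (fun w => dV x (x + w))).
  apply: (@continuous_comp _ _ _ (fun w => (x, x + w)) (fun p => dV p.1 p.2));
    last exact: dVc.
  have wc : (fun w : 'rV[R]_n => x + w) @ nbhs w --> x + w.
    by apply: continuousD; [exact: cst_continuous|exact: cvg_id].
  exact: (@cvg_pair _ _ _ (nbhs w) (nbhs x) (nbhs (x + w)) _ _ _
    (fun=> x) _ (@cst_continuous _ _ x w) wc).
have [|w fw] := @leray_schauder R n f _ r0 fc; last first.
  by exists (x + w); rewrite -[in LHS]fw.
move=> w s wr s1 fw; have w0 : w != 0 by rewrite -normr_gt0 wr.
have := VM (x + w); rewrite addrAC subrr add0r wr.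
have M0 := normr_ge0 M; have MM := ler_norm M.
have tM : 0 <= tau * `|M| by rewrite mulr_ge0// ltW.
case; first lra.
  move=> Vxw; have := dV_mean x (x + w); rewrite addrAC subrr add0r => dVw.
  have : dotp (f w) w <= 0.
    rewrite /f -scaleNr dotpZl dVw mulNr oppr_le0.
    by apply: mulr_ge0; [exact: ltW|rewrite subr_ge0].
  rewrite fw dotpZl leNgt mulr_gt0 ?dotp_gt0//; exact: lt_trans s1.
move=> dVM; have := congr1 Num.norm fw.
rewrite normrN !normrZ wr (gtr0_norm tau0) (gtr0_norm (lt_trans ltr01 s1)).
apply/eqP; rewrite lt_eqF//.
apply: (@le_lt_trans _ _ (tau * `|M|)).
  by rewrite ler_pM2l// (le_trans dVM).
apply: (@lt_trans _ _ (`|M| + tau * `|M| + 1)); first lra.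
by rewrite ltr_pMl.
Qed.

(** * Convex hulls, thickenings and the three cases *)

Lemma sub_convex_hull (R : realType) n (A : set 'rV[R]_n) : A `<=` convex_hull A.
Proof. by move=> z Az C [_]; apply. Qed.

Lemma convex_hull_convex (R : realType) n (A : set 'rV[R]_n) :
  is_convex (convex_hull A).
Proof.
move=> u v t; rewrite !inE => uA vA C [Cconv AC].
have := Cconv u v t; rewrite !inE; apply; [exact: uA|exact: vA].
Qed.

(** Points at distance 0 from [U] lie in its closure, to which bounds on continuous functions
    extend. *)
Lemma thickening0_le (R : realType) n (U : set 'rV[R]_n) (g : 'rV[R]_n -> R) K :
  continuous g -> (forall u, U u -> g u <= K) ->
  forall z, thickening U 0%E z -> g z <= K.
Proof.
move=> gc gK z zU; rewrite leNgt; apply/negP => Kgz.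
have /nbhs_ballP[e /= e0 eP] : \forall w \near z, K < g w.
  exact: cvgr_gt (gc z) _ Kgz.
have /ereal_inf_lt[_ [u Uu <-]] : (set_dist U z < e%:E)%E.
  by apply: le_lt_trans zU _; rewrite lte_fin.
rewrite lte_fin => zu; have := gK u Uu; rewrite leNgt => /negP; apply; apply: eP.
by rewrite -ball_normE /=; apply: le_lt_trans zu; exact: normr_le_enorm.
Qed.

(** The empty set has diameter [-oo], outside the domain where [delta] is constrained. *)
Lemma diam_ge0 (R : realType) n (U : set 'rV[R]_n) : U !=set0 -> (0 <= diam U)%E.
Proof.
move=> [u Uu]; apply: (@le_trans _ _ (enorm (u - u))%:E).
  by rewrite lee_fin sqrtr_ge0.
by apply: ereal_sup_ubound; exists u => //; exists u.
Qed.

Theorem theorem3p6 (R : realType) (n : nat)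
    (dg : ('rV[R]_n -> R) -> 'rV[R]_n -> 'rV[R]_n -> 'rV[R]_n)
    (dg_construction : discrete_gradient_construction dg)
    (Cn : R) (delta : \bar R -> \bar R)
    (dg_assumption : boundedness_locality dg Cn delta)
    (V : 'rV[R]_n -> R) (V_C1 : C1 V)
    (tau : R) (tau_gt0 : 0 < tau) (x : 'rV[R]_n)
    (V_cond :
      [\/ [bounded enorm (grad V z) | z in setT],
          coercive V
        | [/\ [bounded V z | z in convex_hull [set y | V y <= V x]],
              [bounded enorm (grad V z)
                | z in convex_hull [set y | V y <= V x]]
            & forall r : \bar R, (0 <= r)%E -> delta r = 0%E]]) :
  exists y : 'rV[R]_n, y = x - tau *: dg V x y.
Proof.
have dgV := dg_construction V V_C1.
have step := discrete_gradient_step dgV tau_gt0.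
case: V_cond => [/bounded_exists[K gradK]|coV|[_ /bounded_exists[K gradK] delta0]].
(* Taking the whole space as the convex set bounds [dg V] everywhere. *)
- apply: (step (Cn * K)) => y _; right; apply: le_trans (normr_le_enorm _) _.
  apply: (@bl_bounded _ _ _ _ _ dg_assumption V setT) => //.
  + by exists x; exact: filterT.
  + by move=> z _; apply: le_trans (ler_norm _) (gradK z I).
- have /bounded_exists[K VK] := coV (V x).
  (* The sublevel set of [V x] lies in the ball of radius [K] about 0, hence within [K + |x|] of
     [x]. *)
  apply: (step (K + `|x|)) => y xy; left; rewrite leNgt; apply/negP => /ltW Vyx.
  have := xy; apply/negP; rewrite -leNgt.
  apply: le_trans (ler_normB _ _) _; rewrite lerD2r.
  apply: le_trans (normr_le_enorm _) _.
  by apply: le_trans (ler_norm _) _; exact: VK.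
set S := [set y | V y <= V x] in gradK.
have [[u Vux]|Vmin] := pselect (exists u, V u < V x); last first.
  apply: (step 0) => y _; left; rewrite leNgt; apply/negP => Vyx.
  by apply: Vmin; exists y.
have SU := @sub_convex_hull R n S.
apply: (step (Cn * K)) => y _.
have [Vyx|/ltW] := leP (V y) (V x); last by left.
right; apply: le_trans (normr_le_enorm _) _.
apply: (@bl_bounded _ _ _ _ _ dg_assumption V (convex_hull S)) => //.
- exact: convex_hull_convex.
(* The strict inequality at [u] persists nearby, which makes [u] an interior point of the hull. *)
- exists u; have near_u : \forall w \near u, V w < V x.
    exact: cvgr_lt (differentiable_continuous (V_C1.1 u)) _ Vux.
  by apply: filterS near_u => w /ltW; exact: SU.
- rewrite delta0; last by apply: diam_ge0; exists u; exact: SU (ltW Vux).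
  apply: thickening0_le => [|z /gradK]; last exact: le_trans (ler_norm _).
  move=> z; apply: (@continuous_comp _ _ _ (grad V) (@enorm R n));
    last exact: continuous_enorm.
  exact: V_C1.2.
- by apply: SU; rewrite /S /=.
- exact: SU.
Qed.
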